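(* Let $G$ be a planar PCC graph. Then every face $\sigma$ of $G$ satisfies $|\sigma|\le 41$.
   Context: Let $G$ be a finite simple connected graph 2-cell embedded in the sphere (outer face included among the faces). For a face $\sigma$, $|\sigma|$ is the length of its boundary walk. For a vertex $v$, $F(v)$ is the multiset of faces incident to $v$ (one per corner), and $K(v)=1-\frac{\deg(v)}{2}+\sum_{\sigma\in F(v)}\frac{1}{|\sigma|}$. A prism of order $N$: planar graph with $2N$ vertices, two $N$-faces and $N$ quadrilaterals, each vertex incident to two quadrilaterals and one $N$-face. An antiprism of order $N$: planar graph with $2N$ vertices, two $N$-faces and $2N$ triangles, each vertex incident to three triangles and one $N$-face. A planar PCC graph is such a $G$ with $K(v)>0$ and $\deg(v)\ge3$ for all vertices $v$, which is not a prism or an antiprism. *)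

(* Defs.v *)
(* Planar maps (2-cell embeddings in the sphere) encoded as
   combinatorial maps / rotation systems on a finite set of darts. *)
From HB Require Import structures.
From mathcomp Require Import all_boot all_order all_fingroup all_algebra.
Set Implicit Arguments. Unset Strict Implicit. Unset Printing Implicit Defensive.
Import Order.TTheory GRing.Theory Num.Theory.

(* D : darts (half-edges).  s : rotation around vertices (vertices = s-orbits).
   a : edge involution (edges = a-orbits).  Face permutation phi d = s (a d);
   faces = phi-orbits; the length of the boundary walk of a face = size of its
   phi-orbit. *)
Definition face_perm (D : finType) (s a : {perm D}) : {perm D} := (a * s)%g.

Definition spherical_simple_map (D : finType) (s a : {perm D}) : Prop :=
  [/\ (forall d, a (a d) = d),
      (forall d, a d \notin porbit s d),
      (forall d d', d \in porbit s d' -> a d \in porbit s (a d') -> d = d'),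
      (forall d d', connect (fun x y => (y == s x) || (y == a x)) d d')
    & (* Euler: V - E + F = 2, i.e. genus 0 (sphere) *)
      (#|porbits s| + #|porbits (face_perm s a)| = #|porbits a| + 2)%N].

Definition deg (D : finType) (s : {perm D}) (d : D) : nat := #|porbit s d|.

Definition face_len (D : finType) (s a : {perm D}) (d : D) : nat :=
  #|porbit (face_perm s a) d|.

(* Combinatorial curvature of the vertex at dart d.  The corners at a vertex
   are in bijection with the darts e at it; the corner preceding e lies in
   the face of e. *)
Local Open Scope ring_scope.
Definition curvature (D : finType) (s a : {perm D}) (d : D) : rat :=
  1 - (deg s d)%:R / 2 + \sum_(e in porbit s d) ((face_len s a e)%:R)^-1.

Local Close Scope ring_scope.
Definition is_prism (D : finType) (s a : {perm D}) : Prop :=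
  exists (N : nat) (d1 d2 : D),
    let special e := (e \in porbit (face_perm s a) d1) ||
                     (e \in porbit (face_perm s a) d2) in
    [/\ d2 \notin porbit (face_perm s a) d1,
        face_len s a d1 = N /\ face_len s a d2 = N,
        #|porbits s| = (2 * N)%N /\
        #|porbits (face_perm s a)| = (N + 2)%N,
        (forall e, ~~ special e -> face_len s a e = 4%N)
      & (forall d, deg s d = 3%N /\ #|[set e in porbit s d | special e]| = 1%N)].

Definition is_antiprism (D : finType) (s a : {perm D}) : Prop :=
  exists (N : nat) (d1 d2 : D),
    let special e := (e \in porbit (face_perm s a) d1) ||
                     (e \in porbit (face_perm s a) d2) in
    [/\ d2 \notin porbit (face_perm s a) d1,
        face_len s a d1 = N /\ face_len s a d2 = N,
        #|porbits s| = (2 * N)%N /\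
        #|porbits (face_perm s a)| = (2 * N + 2)%N,
        (forall e, ~~ special e -> face_len s a e = 3%N)
      & (forall d, deg s d = 4%N /\ #|[set e in porbit s d | special e]| = 1%N)].

Definition planar_PCC (D : finType) (s a : {perm D}) : Prop :=
  [/\ spherical_simple_map s a,
      (forall d, (0 < curvature s a d)%R),
      (forall d, (3 <= deg s d)%N),
      ~ is_prism s a
    & ~ is_antiprism s a].

(* Main.v *)
(* Let sigma be a face with N >= 42 edges.  Positivity of the curvature forces
   every vertex of sigma to have type (3,3,N), (3,4,N), (3,5,N), (3,6,N), (4,4,N)
   or (3,3,3,N), with curvature 1/N plus respectively 1/6, 1/12, 1/30, 0, 0, 0.
   So the vertices of sigma already carry curvature at least 1 out of a total
   of 2, and it suffices to find an average of at least 1/41 > 1/42 per vertex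
   in addition.  This is done by discharging: the first three types have some to
   spare, and the rest is paid by the vertices one step away from sigma, namely
   the apexes of the triangles and the ends of the edges between two
   quadrilaterals.  Such a vertex has enough curvature unless it lies on a second
   face with at least 42 edges; in that case the same holds at the next vertex
   of sigma, hence all around sigma, and the graph is a prism or an antiprism.
   Only when a vertex (3,3,3,N) lies between two vertices (3,6,N) may a vertex
   two steps away from sigma have to contribute as well. *)
From HB Require Import structures.
From mathcomp Require Import all_boot all_order all_fingroup all_algebra.
From mathcomp Require Import ring lra zify.
Require Import Defs.
Set Implicit Arguments. Unset Strict Implicit. Unset Printing Implicit Defensive.
Import Order.TTheory GRing.Theory Num.Theory.
Local Open Scope ring_scope.

(** * Sums over the orbits of a permutation *)

Section PermOrbits.
Variables (T : finType) (p : {perm T}).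

Lemma big_porbit (R : nmodType) (x : T) (F : T -> R) :
  \sum_(y in porbit p x) F y = \sum_(y <- traject p x #|porbit p x|) F y.
Proof.
rewrite big_uniq ?uniq_traject_porbit //=.
by apply: eq_bigl => y; rewrite porbit_traject.
Qed.

Lemma porbit_perm x : p x \in porbit p x.
Proof. exact: (mem_porbit p 1 x). Qed.

Lemma eq_porbit_perm x : porbit p (p x) = porbit p x.
Proof. by apply/eqP; rewrite eq_porbit_mem porbit_perm. Qed.

Lemma porbit_eq x y : y \in porbit p x -> porbit p y = porbit p x.
Proof. by rewrite -eq_porbit_mem => /eqP ->. Qed.

Lemma card_porbit_gt0 x : (0 < #|porbit p x|)%N.
Proof. by apply/card_gt0P; exists x; exact: porbit_id. Qed.

Lemma sum_porbit_const (R : nmodType) (F : T -> R) :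
  \sum_x F x = \sum_(A in porbits p) \sum_(x in A) F x.
Proof.
rewrite (partition_big (porbit p) (mem (porbits p))) /=; last first.
  by move=> x _; apply: imset_f.
apply: eq_bigr => A /imsetP[x _ ->]; apply: eq_bigl => y.
by rewrite eq_porbit_mem.
Qed.

(** An orbit of size n contributes n terms 1/n. In this way sums over darts count vertices, edges
    and faces. *)
Lemma sum_inv_card_porbit :
  \sum_x (#|porbit p x|%:R)^-1 = #|porbits p|%:R :> rat.
Proof.
rewrite sum_porbit_const -sum1_card natr_sum; apply: eq_bigr => A /imsetP[x _ ->].
rewrite (eq_bigr (fun=> (#|porbit p x|%:R)^-1)) => [|y /porbit_eq -> //].
rewrite sumr_const -[_ *+ _]mulr_natr mulVf // pnatr_eq0 -lt0n.
exact: card_porbit_gt0.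
Qed.

(** Averaging over orbits keeps the sum. This turns an inequality at each vertex into one between
    sums over darts weighted by 1/deg. *)
Lemma sum_avg_porbit (F : T -> rat) :
  \sum_x F x = \sum_x (#|porbit p x|%:R)^-1 * \sum_(y in porbit p x) F y.
Proof.
rewrite [LHS]sum_porbit_const [RHS]sum_porbit_const.
apply: eq_bigr => A /imsetP[x _ ->].
rewrite [RHS](eq_bigr (fun=> (#|porbit p x|%:R)^-1 *
  \sum_(y in porbit p x) F y)) => [|y /porbit_eq -> //].
rewrite sumr_const -[_ *+ _]mulr_natr mulrAC mulVf ?mul1r // pnatr_eq0 -lt0n.
exact: card_porbit_gt0.
Qed.

End PermOrbits.

(** * Curvature of a spherical map *)

Section Map.
Variables (D : finType) (s a : {perm D}).
Hypothesis sph : spherical_simple_map s a.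
Hypothesis Kpos : forall d, 0 < curvature s a d.
Hypothesis degge3 : forall d, (3 <= deg s d)%N.

Local Notation phi := (face_perm s a).
Local Notation L := (face_len s a).
Local Notation K := (curvature s a).
Local Notation dg := (deg s).

Lemma aK d : a (a d) = d.
Proof. by case: sph => h *; apply: h. Qed.

Lemma phiE d : phi d = s (a d).
Proof. by rewrite permM. Qed.

Lemma phiaE d : phi (a d) = s d.
Proof. by rewrite phiE aK. Qed.

Lemma a_inj : injective a. Proof. exact: perm_inj. Qed.
Lemma s_inj : injective s. Proof. exact: perm_inj. Qed.

Lemma L_phi d : L (phi d) = L d.
Proof. by rewrite /face_len eq_porbit_perm. Qed.

Lemma L_s d : L (s d) = L (a d).
Proof. by rewrite -phiaE L_phi. Qed.

Lemma dg_s d : dg (s d) = dg d.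
Proof. by rewrite /deg eq_porbit_perm. Qed.

Lemma K_porbit d e : e \in porbit s d -> K e = K d.
Proof. by move=> h; rewrite /curvature /deg (porbit_eq h). Qed.

Lemma K_s d : K (s d) = K d.
Proof. by apply: K_porbit; exact: porbit_perm. Qed.

Lemma iter_L d : iter (L d) phi d = d.
Proof. exact: iter_porbit. Qed.

Lemma iter_dg d : iter (dg d) s d = d.
Proof. exact: iter_porbit. Qed.

(** A face of length 1 would give a loop. One of length 2 would have two parallel edges, which
    simplicity identifies, leaving a vertex of degree 1. *)
Lemma L_ge3 d : (2 < L d)%N.
Proof.
case: sph => _ noloop nomulti _ _.
have := iter_L d; have := card_porbit_gt0 phi d.
rewrite -[#|_|]/(L d); case: (L d) => [//|[|[|n]]] //= _.
  by rewrite phiE => h; have := noloop (a d); rewrite aK -{1}h porbit_perm.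
rewrite !phiE => h.
pose x := a (s (a d)).
have hx : s x = d by [].
have dx : d = x.
  apply: nomulti; first by rewrite -{1}hx porbit_perm.
  by rewrite aK porbit_sym porbit_perm.
have sd : s d = d by rewrite {1}dx.
have := degge3 d; rewrite /deg.
have := card_porbit_gt0 s d.
suff -> : #|porbit s d| = 1%N by [].
have := uniq_traject_porbit s d; case: #|_| (card_porbit_gt0 s d) => [//|[//|n]] _ /=.
by rewrite sd inE eqxx.
Qed.

Definition r d : rat := (L d)%:R^-1.

Lemma r_bound d : 0 < r d <= 1/3.
Proof.
rewrite /r invr_gt0 ltr0n (leq_trans _ (L_ge3 d)) //=.
rewrite div1r lef_pV2 ?posrE ?ltr0n ?ler_nat ?L_ge3 //.
exact: leq_trans (L_ge3 d).
Qed.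

Lemma dg_le5 d : (dg d <= 5)%N.
Proof.
have := Kpos d; rewrite /curvature.
have : \sum_(e in porbit s d) (L e)%:R^-1 <= \sum_(e in porbit s d) (1/3 : rat).
  by apply: ler_sum => e _; case/andP: (r_bound e).
rewrite sumr_const -[#|_|]/(dg d) -mulr_natr => h1 h2.
rewrite leqNgt -(ltr_nat rat); apply/negP => h3.
have h6 : (6%:R : rat) <= (dg d)%:R by rewrite ler_nat -(ltr_nat rat).
lra.
Qed.

Lemma dgP d : [\/ dg d = 3%N, dg d = 4%N | dg d = 5%N].
Proof.
have := degge3 d; have := dg_le5 d.
by case: (dg d) => [|[|[|[|[|[|n]]]]]] // _ _; [apply: Or31|apply: Or32|apply: Or33].
Qed.

Lemma sum3 d (F : D -> rat) : dg d = 3%N ->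
  \sum_(e in porbit s d) F e = F d + F (s d) + F (s (s d)).
Proof. by move=> h; rewrite big_porbit -[#|_|]/(dg d) h !big_cons big_nil; ring. Qed.

Lemma sum4 d (F : D -> rat) : dg d = 4%N ->
  \sum_(e in porbit s d) F e = F d + F (s d) + F (s (s d)) + F (s (s (s d))).
Proof. by move=> h; rewrite big_porbit -[#|_|]/(dg d) h !big_cons big_nil; ring. Qed.

Lemma sum5 d (F : D -> rat) : dg d = 5%N ->
  \sum_(e in porbit s d) F e =
  F d + F (s d) + F (s (s d)) + F (s (s (s d))) + F (s (s (s (s d)))).
Proof. by move=> h; rewrite big_porbit -[#|_|]/(dg d) h !big_cons big_nil; ring. Qed.

Lemma K3 d : dg d = 3%N -> K d = r d + r (s d) + r (s (s d)) - 1/2.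
Proof. by move=> h; rewrite /curvature h sum3 //= /r; lra. Qed.

Lemma K4 d : dg d = 4%N ->
  K d = r d + r (s d) + r (s (s d)) + r (s (s (s d))) - 1.
Proof. by move=> h; rewrite /curvature h sum4 //= /r; lra. Qed.

Lemma K5 d : dg d = 5%N ->
  K d = r d + r (s d) + r (s (s d)) + r (s (s (s d))) + r (s (s (s (s d)))) - 3/2.
Proof. by move=> h; rewrite /curvature h sum5 //= /r; lra. Qed.

Lemma s3 d : dg d = 3%N -> s (s (s d)) = d.
Proof. by move=> h; have := iter_dg d; rewrite h. Qed.
Lemma s4 d : dg d = 4%N -> s (s (s (s d))) = d.
Proof. by move=> h; have := iter_dg d; rewrite h. Qed.
Lemma s5 d : dg d = 5%N -> s (s (s (s (s d)))) = d.
Proof. by move=> h; have := iter_dg d; rewrite h. Qed.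

Lemma L3 d : L d = 3%N -> phi (phi (phi d)) = d.
Proof. by move=> h; have := iter_L d; rewrite h. Qed.

Lemma card_porbits_a : (#|porbits a| * 2)%N = #|D|.
Proof.
apply/eqP; rewrite -(eqr_nat rat) natrM -sum_inv_card_porbit.
rewrite (eq_bigr (fun=> 1/2)) => [|d _].
  by rewrite sumr_const -mulr_natr; apply/eqP; field.
suff -> : #|porbit a d| = 2%N by [].
have nd : a d != d.
  apply/eqP => h; case: sph => _ /(_ d) + _ _ _.
  by rewrite h porbit_id.
have -> : porbit a d = [set d; a d].
  apply/setP => x; rewrite !inE; apply/porbitP/orP => [[n ->]|].
    elim: n => [|n]; rewrite ?expg0 ?perm1 ?eqxx; first by left.
    by rewrite expgSr permM => -[/eqP ->|/eqP ->]; rewrite ?aK eqxx; [right|left].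
  by case=> /eqP ->; [exists 0%N; rewrite expg0 perm1|exists 1%N; rewrite expg1].
by rewrite cards2 eq_sym nd.
Qed.

(** Discrete Gauss-Bonnet: over all darts, 1/deg, 1/2 and 1/L sum to the numbers of vertices, edges
    and faces. *)
Lemma total_curvature : \sum_d (dg d)%:R^-1 * K d = 2.
Proof.
rewrite (eq_bigr (fun d => (dg d)%:R^-1 - 1/2 +
   (dg d)%:R^-1 * \sum_(e in porbit s d) r e)) => [|d _]; last first.
  rewrite /curvature -[X in _ = _ + _ * X]/(\sum_(e in porbit s d) (L e)%:R^-1).
  field; rewrite pnatr_eq0 -lt0n; exact: card_porbit_gt0.
rewrite big_split /= -sum_avg_porbit sumrB !sum_inv_card_porbit.
have -> : \sum_(d : D) (1/2 : rat) = #|porbits a|%:R.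
  by rewrite sumr_const -(mulr_natr (1/2)) -card_porbits_a natrM; field.
case: sph => _ _ _ _ /(congr1 (fun n : nat => n%:R : rat)).
rewrite !natrD => h; lra.
Qed.

(* [lra] reads the ordered field off the conclusion, so [False] is replaced by
   a false rational inequality. *)
Lemma lt10_absurd : (1 < 0 :> rat) -> False.
Proof. by rewrite ltr10. Qed.
Ltac absurd_lra := exfalso; apply: lt10_absurd; lra.
Ltac numeric :=
  lazymatch goal with
  | |- is_true _ => lra
  | |- _ => first [assumption | absurd_lra]
  end.

(** * Vertices on large faces *)

Variant len_spec (n : nat) (x : rat) : Prop :=
  | Len3 of n = 3%N & x = 1/3
  | Len4 of n = 4%N & x = 1/4
  | Len5 of n = 5%N & x = 1/5
  | Len6 of n = 6%N & x = 1/6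
  | Len7 of n = 7%N & x = 1/7
  | Len8 of (7 < n)%N & 0 < x <= 1/8.

Lemma r_le d n : (n < L d)%N -> r d <= n.+1%:R^-1.
Proof.
by move=> h; rewrite /r lef_pV2 ?posrE ?ltr0n ?ler_nat //; apply: leq_trans h.
Qed.

Lemma lenP d : len_spec (L d) (r d).
Proof.
have := L_ge3 d; have : r d = (L d)%:R^-1 by [].
have [h8 _ _|] := ltnP 7 (L d).
  apply: Len8 => //; have := r_le h8; case/andP: (r_bound d) => -> _ /=; lra.
case: (L d) => [|[|[|[|[|[|[|[|n]]]]]]]] // _ -> _;
  [exact: Len3|exact: Len4|exact: Len5|exact: Len6|exact: Len7].
Qed.

Definition large d := (41 < L d)%N.

Lemma r_large d : large d -> 0 < r d <= 1/42.
Proof. by move=> /r_le h; case/andP: (r_bound d) => -> _ /=; lra. Qed.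

Lemma r_small d : ~~ large d -> 1/41 <= r d.
Proof.
rewrite /large -leqNgt /r => h; rewrite div1r lef_pV2 ?posrE ?ltr0n ?ler_nat //.
exact: leq_trans (L_ge3 d).
Qed.

Lemma large_phi d : large (phi d) = large d.
Proof. by rewrite /large L_phi. Qed.

(* The constructors are indexed by the degree and by the lengths of the two
   faces sharing an edge of the large face with the vertex. *)
Variant large_spec : nat -> nat -> nat -> Prop :=
  | Large333 : large_spec 4 3 3
  | Large33 : large_spec 3 3 3
  | Large34 : large_spec 3 3 4
  | Large43 : large_spec 3 4 3
  | Large35 : large_spec 3 3 5
  | Large53 : large_spec 3 5 3
  | Large36 : large_spec 3 3 6
  | Large63 : large_spec 3 6 3
  | Large44 : large_spec 3 4 4.

(** The threshold is sharp: 1/3 + 1/7 + 1/42 = 1/2, so type (3,7,N) loses its positive curvature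
    exactly at N = 42. *)
Lemma largeP d : large d -> large_spec (dg d) (L (s d)) (L (s (s d))).
Proof.
move=> /r_large hr; have := Kpos d; case: (dgP d) => hd; rewrite hd.
- rewrite (K3 hd); case: (lenP (s d)) => h1 hr1; case: (lenP (s (s d))) => h2 hr2 hK;
  first [absurd_lra|rewrite h1 h2; constructor].
- have := r_bound (s (s (s d))).
  rewrite (K4 hd); case: (lenP (s d)) => h1 hr1; case: (lenP (s (s d))) => h2 hr2 hr3 hK;
  first [absurd_lra|rewrite h1 h2; constructor].
- have := r_bound (s (s (s d))); have := r_bound (s (s d)); have := r_bound (s d).
  have := r_bound (s (s (s (s d)))).
  rewrite (K5 hd) => *; absurd_lra.
Qed.

Lemma large_dg d : large d -> dg d = 3%N \/ dg d = 4%N.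
Proof. by move=> h; case: (largeP h); [right|left..]. Qed.

Lemma large4 d : large d -> dg d = 4%N ->
  [/\ L (s d) = 3, L (s (s d)) = 3 & L (s (s (s d))) = 3]%N.
Proof.
move=> hl hd; case: (largeP hl) (hd) => // _; split=> //.
have := r_large hl; have := Kpos d.
have := r_bound (s d); have := r_bound (s (s d)).
rewrite (K4 hd); case: (lenP (s (s (s d)))) => // h3 hr *; absurd_lra.
Qed.

(* [q d] is the reverse of the edge following [d] at its vertex.  If the face
   across [d] is a triangle, [q d] starts at its apex and the faces at [q d],
   [s (q d)], [s (s (q d))] are the triangle's left neighbour, the triangle and
   its right neighbour. *)
Definition q : {perm D} := (s * a)%g.

Lemma qE d : q d = a (s d).
Proof. by rewrite permM. Qed.

Lemma L_q d : L (q d) = L (s (s d)).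
Proof. by rewrite qE L_s. Qed.

Lemma L_sq d : L (s (q d)) = L (s d).
Proof. by rewrite L_s qE aK. Qed.

(** The triangle closes after three steps, so its third side, reversed, sits two places before
    [phi d] in the rotation at the far end of [d]. *)
Lemma apex_tri d : L (s d) = 3%N -> s (s (a (s (q d)))) = phi d.
Proof.
move/L3; rewrite !phiE -(qE d) => h.
by congr (s _); apply: a_inj; apply: s_inj; rewrite h aK.
Qed.

Lemma apex_tri3 d : L (s d) = 3%N -> dg (phi d) = 3%N ->
  a (s (q d)) = s (phi d).
Proof.
move=> hl hd; apply: s_inj; apply: s_inj.
by rewrite apex_tri // s3.
Qed.

Lemma apex_tri4 d : L (s d) = 3%N -> dg (phi d) = 4%N ->
  a (s (q d)) = s (s (phi d)).
Proof.
move=> hl hd; apply: s_inj; apply: s_inj.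
by rewrite apex_tri // s4.
Qed.

Lemma apex_next3 d : L (s d) = 3%N -> dg (phi d) = 3%N ->
  L (s (s (q d))) = L (s (phi d)).
Proof. by move=> hl hd; rewrite L_s apex_tri3. Qed.

Lemma apex_next4 d : L (s d) = 3%N -> dg (phi d) = 4%N ->
  L (s (s (q d))) = L (s (s (phi d))).
Proof. by move=> hl hd; rewrite L_s apex_tri4. Qed.

(* Otherwise the far end of [d] would lie on two large faces. *)
Lemma apex_next_small d : large d -> L (s d) = 3%N ->
  ~~ large (s (s (q d))).
Proof.
rewrite -large_phi => hg hl; rewrite /large -leqNgt.
case: (dgP (phi d)) => hd; rewrite ?(apex_next3 hl hd) ?(apex_next4 hl hd);
  by move: hd; case: (largeP hg).
Qed.

(** The middle one of the three triangles at the end [phi d] joins two apexes: [s (s (q d))] leads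
    from the apex over [d] to the apex over [phi d]. *)
Lemma apex_mid d : L (s d) = 3%N -> dg (phi d) = 4%N -> L (s (s (phi d))) = 3%N ->
  s (a (s (s (q d)))) = q (phi d).
Proof.
move=> hl hd /L3.
have h : phi (s (s (phi d))) = s (s (q d)) by rewrite phiE -apex_tri4 // aK.
rewrite h -phiE => h'; apply: (@perm_inj _ phi).
by rewrite h' qE phiaE.
Qed.

Lemma r_eq d n : L d = n -> r d = n%:R^-1.
Proof. by rewrite /r => ->. Qed.

(** Type (3,3,6,5) has curvature 1/30, the next one (3,3,6,4) already 1/12, and with degree 5
    nothing positive remains. The lemma after this is the mirror image. *)
Lemma apex336 p : L p = 3%N -> L (s p) = 3%N -> L (s (s p)) = 6%N ->
  1/30 <= K p /\ (K p < 1/12 -> dg p = 4%N /\ L (s (s (s p))) = 5%N).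
Proof.
move=> /r_eq h0 /r_eq h1 /r_eq h2; have := Kpos p.
have := r_bound (s (s (s p))); have := r_bound (s (s (s (s p)))).
case: (dgP p) => hd; rewrite ?(K3 hd) ?(K4 hd) ?(K5 hd) => h4 h3 hK; last by numeric.
  by split=> *; [|split]; numeric.
by case: (lenP (s (s (s p)))) => l3 h3'; split=> [|hK']; rewrite ?hd; try split=> //; numeric.
Qed.

Lemma apex633 p : L p = 6%N -> L (s p) = 3%N -> L (s (s p)) = 3%N ->
  1/30 <= K p /\ (K p < 1/12 -> dg p = 4%N /\ L (s (s (s p))) = 5%N).
Proof.
move=> /r_eq h0 /r_eq h1 /r_eq h2; have := Kpos p.
have := r_bound (s (s (s p))); have := r_bound (s (s (s (s p)))).
case: (dgP p) => hd; rewrite ?(K3 hd) ?(K4 hd) ?(K5 hd) => h4 h3 hK; last by numeric.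
  by split=> *; [|split]; numeric.
by case: (lenP (s (s (s p)))) => l3 h3'; split=> [|hK']; rewrite ?hd; try split=> //; numeric.
Qed.

(** With degree 5 the fifth face must be a triangle, which leaves exactly 1/30. *)
Lemma apex5333 p : L p = 5%N -> L (s p) = 3%N -> L (s (s p)) = 3%N ->
  L (s (s (s p))) = 3%N -> 1/30 <= K p.
Proof.
move=> l0 /r_eq h1 /r_eq h2 l3; have h0 := r_eq l0; have h3 := r_eq l3.
have := Kpos p; have := r_bound (s (s (s (s p)))).
case: (dgP p) => hd; rewrite ?(K3 hd) ?(K4 hd) ?(K5 hd) => h4 hK.
- by exfalso; move: l3; rewrite (s3 hd) l0.
- lra.
- by case: (lenP (s (s (s (s p))))) => *; numeric.
Qed.

Lemma apex3335 p : L p = 3%N -> L (s p) = 3%N -> L (s (s p)) = 3%N ->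
  L (s (s (s p))) = 5%N -> 1/30 <= K p.
Proof.
move=> /r_eq h0 /r_eq h1 /r_eq h2 /r_eq h3.
have := Kpos p; have := r_bound (s (s (s (s p)))).
case: (dgP p) => hd; rewrite ?(K3 hd) ?(K4 hd) ?(K5 hd) => h4 hK; try lra.
by case: (lenP (s (s (s (s p))))) => *; numeric.
Qed.

Lemma in_porbit3 d x : dg d = 3%N -> x \in porbit s d ->
  [\/ x = d, x = s d | x = s (s d)].
Proof.
move=> hd; rewrite porbit_traject -[#|_|]/(dg d) hd !inE.
by case/or3P => /eqP ->; [apply: Or31|apply: Or32|apply: Or33].
Qed.

Lemma in_porbit4 d x : dg d = 4%N -> x \in porbit s d ->
  [\/ x = d, x = s d, x = s (s d) | x = s (s (s d))].
Proof.
move=> hd; rewrite porbit_traject -[#|_|]/(dg d) hd !inE.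
by case/or4P => /eqP ->; [apply: Or41|apply: Or42|apply: Or43|apply: Or44].
Qed.

Lemma s_porbit d e : (s d \in porbit s e) = (d \in porbit s e).
Proof. by rewrite -!eq_porbit_mem eq_porbit_perm. Qed.

Lemma large_sigma d0 d : large d0 -> d \in porbit phi d0 -> large d.
Proof. by move=> h hd; rewrite /large /face_len (porbit_eq hd). Qed.

Lemma phi_sigma d0 d : (phi d \in porbit phi d0) = (d \in porbit phi d0).
Proof. by rewrite -!eq_porbit_mem eq_porbit_perm. Qed.

Lemma sigma_ind d0 (P : D -> Prop) :
  P d0 -> (forall d, d \in porbit phi d0 -> P d -> P (phi d)) ->
  forall d, d \in porbit phi d0 -> P d.
Proof.
move=> P0 PS d /porbitP[n ->]; elim: n => [|n ih]; first by rewrite expg0 perm1.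
by rewrite expgSr permM; apply: PS => //; apply: mem_porbit.
Qed.

(** * Prisms and antiprisms *)

(* A large face [sigma] and a second face traversed backwards by [psi], joined by
   a ring of [m]-gons: [k = 3, m = 4] is a prism, [k = 4, m = 3] an antiprism. *)
Section Ladder.
Variables (d0 : D) (psi : {perm D}) (k m : nat).
Local Notation sigma := (porbit phi d0).
Hypothesis large0 : large d0.
Hypothesis m_le : (m <= 41)%N.
Hypothesis k_gt0 : (0 < k)%N.
Hypothesis dg_sigma : forall d, d \in sigma -> dg d = k.
Hypothesis dg_psi : forall d, d \in sigma -> dg (psi d) = k.
Hypothesis psi_phi : forall d, d \in sigma -> phi (psi (phi d)) = psi d.
Hypothesis K_sigma : forall d, d \in sigma -> K d = r d.
Hypothesis L_sigma : forall d, d \in sigma ->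
  forall x, x \in porbit s d -> x != d -> L x = m.
Hypothesis L_psi : forall d, d \in sigma ->
  forall x, x \in porbit s (psi d) -> x != psi d -> L x = m.
Definition on_ladder x :=
  exists2 d, d \in sigma & x \in porbit s d \/ x \in porbit s (psi d).
Hypothesis ladder_a : forall x, on_ladder x -> on_ladder (a x).

Lemma psi_sigma : porbit phi (psi d0) = psi @: sigma.
Proof.
apply/setP => x; apply/idP/imsetP => [|[d hd ->]].
  case/porbitP => n ->; elim: n => [|n [d hd]].
    by exists d0; rewrite ?porbit_id // expg0 perm1.
  have hd' : (phi^-1)%g d \in sigma by rewrite -phi_sigma permKV.
  rewrite expgSr permM => ->; exists ((phi^-1)%g d) => //.
  by have := psi_phi hd'; rewrite permKV.
move: d hd; apply: sigma_ind => [|d hd ih]; first exact: porbit_id.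
by rewrite -phi_sigma psi_phi.
Qed.

Lemma L_psi_sigma : L (psi d0) = L d0.
Proof. by rewrite /face_len psi_sigma card_imset //; apply: perm_inj. Qed.

Lemma ladder_all x : on_ladder x.
Proof.
case: sph => _ _ _ /(_ d0 x)/connectP[p hp ->] _.
have: on_ladder d0 by exists d0; [exact: porbit_id|left; exact: porbit_id].
elim: p d0 hp => //= y p ih z /andP[/orP[]/eqP -> hp] hz; apply: ih => //.
  by case: hz => d hd hx; exists d => //; rewrite !s_porbit.
exact: ladder_a.
Qed.

(* If both rails were the same face, its L d0 vertices, of curvature 1 / L d0
   each, would be all the vertices; but the total curvature is 2. *)
Lemma psi0_notin : psi d0 \notin sigma.
Proof.
apply/negP => h.
have hpsi d : d \in sigma -> psi d \in sigma.
  by move=> hd; rewrite -(porbit_eq h) psi_sigma imset_f.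
pose F e := if e \in sigma then K e else 0.
have hF x d : d \in sigma -> x \in porbit s d -> \sum_(y in porbit s x) F y = K x.
  move=> hd hx; rewrite (porbit_eq hx) (bigD1 d) ?porbit_id //= big1 => [|y /andP[hy nyd]].
    by rewrite addr0 /F hd (K_porbit hx).
  rewrite /F ifF //; apply/negP => /(large_sigma large0).
  by rewrite /large (L_sigma hd) // ltnNge m_le.
have := total_curvature; rewrite (eq_bigr (fun d => (dg d)%:R^-1 *
   \sum_(y in porbit s d) F y)) => [|x _]; last first.
  by have [d hd [hx|hx]] := ladder_all x; rewrite (hF _ _ _ hx) ?hpsi.
rewrite -sum_avg_porbit -big_mkcond /= (eq_bigr (fun=> (L d0)%:R^-1)) => [|d hd].
  rewrite sumr_const -[#|_|]/(L d0) -(mulr_natr ((L d0)%:R^-1)) mulVf //.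
  by rewrite pnatr_eq0 -lt0n; apply: ltn_trans (L_ge3 d0).
by rewrite K_sigma // /r /face_len (porbit_eq hd).
Qed.

Definition on_rail e := (e \in sigma) || (e \in porbit phi (psi d0)).

Lemma on_rail_large e : on_rail e -> large e.
Proof.
case/orP => [|he]; first exact: large_sigma.
by rewrite /large /face_len (porbit_eq he) -[#|_|]/(L _) L_psi_sigma.
Qed.

Lemma rail_vertex x : exists e, [/\ on_rail e, x \in porbit s e, dg e = k
  & forall y, y \in porbit s e -> y != e -> L y = m].
Proof.
have [d hd [hx|hx]] := ladder_all x.
  by exists d; rewrite /on_rail hd dg_sigma //; split=> //; apply: L_sigma.
exists (psi d); rewrite /on_rail psi_sigma imset_f ?orbT // dg_psi //.
by split=> //; apply: L_psi.
Qed.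

Lemma on_railE x e : on_rail e -> x \in porbit s e ->
  (forall y, y \in porbit s e -> y != e -> L y = m) -> on_rail x = (x == e).
Proof.
move=> he hx hL; apply/idP/eqP => [hr|->] //; apply/eqP; apply: contraLR hr => hne.
by apply/negP => /on_rail_large; rewrite /large hL // ltnNge m_le.
Qed.

Lemma dg_ladder x : dg x = k.
Proof.
have [e [_ hx <- _]] := rail_vertex x.
by rewrite /deg (porbit_eq hx).
Qed.

Lemma card_rail_vertex x : #|[set e in porbit s x | on_rail e]| = 1%N.
Proof.
have [e [he hx _ hL]] := rail_vertex x.
rewrite (porbit_eq hx) (_ : [set _ in _ | _] = [set e]) ?cards1 //.
apply/setP => y; rewrite !inE; apply/andP/eqP => [[hy]|->].
  by rewrite (on_railE he) // => /eqP.
by rewrite he porbit_id.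
Qed.

Lemma L_off_rail x : ~~ on_rail x -> L x = m.
Proof.
have [e [he hx _ hL]] := rail_vertex x.
by rewrite (on_railE he) //; apply: hL.
Qed.

Lemma card_vertices : #|porbits s| = (2 * L d0)%N.
Proof.
apply/eqP; rewrite -(eqr_nat rat) -sum_inv_card_porbit.
rewrite (eq_bigr (fun x => (dg x)%:R^-1 *
   \sum_(y in porbit s x) (on_rail y)%:R)) => [|x _]; last first.
  rewrite -natr_sum -big_mkcondr sum1_card /=.
  have := card_rail_vertex x; rewrite cardsE => ->.
  by rewrite mulr1.
rewrite -sum_avg_porbit -natr_sum -big_mkcond sum1_card eqr_nat.
apply/eqP; rewrite (eq_card (B := mem (sigma :|: porbit phi (psi d0)))) => [|x].
  rewrite cardsU disjoint_setI0 ?cards0 ?subn0.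
    by rewrite -[#|porbit _ (psi _)|]/(L _) L_psi_sigma mul2n addnn.
  rewrite disjoint_subset; apply/subsetP => x hx; rewrite inE.
  apply: contra psi0_notin => hx'.
  by rewrite -(porbit_eq hx) (porbit_eq hx') porbit_id.
by rewrite !inE.
Qed.

(** Euler's formula with V = 2L and 2E = kV, doubled to avoid a division. *)
Lemma card_faces : (#|porbits phi| * 2 = 2 * k * L d0 + 4 - 4 * L d0)%N.
Proof.
have hV : (#|porbits s| * k)%N = #|D|.
  apply/eqP; rewrite -(eqr_nat rat) natrM -sum_inv_card_porbit.
  rewrite (eq_bigr (fun=> k%:R^-1)) => [|x _]; last by rewrite -[#|_|]/(dg x) dg_ladder.
  by rewrite sumr_const -(mulr_natr (k%:R^-1)) mulrAC mulVf ?mul1r // pnatr_eq0 -lt0n.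
have hE := card_porbits_a; case: sph => _ _ _ _.
move: hV hE; rewrite card_vertices.
set E := #|porbits a|; set F := #|porbits _|; set N := L d0; set n := #|D|.
move=> hV hE hF; lia.
Qed.

Lemma ladderP :
  [/\ psi d0 \notin sigma, L d0 = L d0 /\ L (psi d0) = L d0,
      #|porbits s| = (2 * L d0)%N /\
        (#|porbits phi| * 2 = 2 * k * L d0 + 4 - 4 * L d0)%N,
      forall e, ~~ on_rail e -> L e = m
    & forall d, dg d = k /\ #|[set e in porbit s d | on_rail e]| = 1%N].
Proof.
split; [exact: psi0_notin|by rewrite L_psi_sigma|..|by split; [exact: dg_ladder|exact: card_rail_vertex]].
- by split; [exact: card_vertices|exact: card_faces].
- exact: L_off_rail.
Qed.

End Ladder.

Lemma phi_pred d0 d : d \in porbit phi d0 -> exists2 d', d' \in porbit phi d0 & d = phi d'.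
Proof.
move=> hd; exists ((phi^-1)%g d); last by rewrite permKV.
by rewrite -phi_sigma permKV.
Qed.

(** Candidates for the passage to the second rail: the last corner at the far end of [s d], when
    that end has degree 3 (prism) or 4 (antiprism). *)
Definition psi3 : {perm D} := (q * s * s)%g.
Definition psi4 : {perm D} := (q * s * s * s)%g.

Lemma psi3E d : psi3 d = s (s (q d)). Proof. by rewrite !permM. Qed.
Lemma psi4E d : psi4 d = s (s (s (q d))). Proof. by rewrite !permM. Qed.

Lemma porbit_psi3 d : porbit s (psi3 d) = porbit s (q d).
Proof. by rewrite psi3E !eq_porbit_perm. Qed.
Lemma porbit_psi4 d : porbit s (psi4 d) = porbit s (q d).
Proof. by rewrite psi4E !eq_porbit_perm. Qed.

(* The apex of the triangle across [d] lies on a second large face. *)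
Definition rung4 d := [/\ dg d = 4, dg (phi d) = 4, dg (q d) = 4 & large (psi4 d)]%N.

(** The edge joining the apexes over [d] and [phi d] borders the second large face, so that face
    passes through the next apex too. *)
Lemma rung4_step d : large d -> rung4 d ->
  rung4 (phi d) /\ phi (psi4 (phi d)) = psi4 d.
Proof.
move=> hl [hd hg hq hX]; have hlg : large (phi d) by rewrite large_phi.
have [l1 _ _] := large4 hl hd; have [m1 m2 _] := large4 hlg hg.
pose x := a (s (s (q d))).
have sx : s x = q (phi d) by apply: apex_mid.
have hx : large x by rewrite /large -L_s -psi4E.
have nl := apex_next_small hlg m1.
have dx : dg x = 4%N.
  by case: (large_dg hx) => // d3; case/negP: nl; rewrite -sx (s3 d3).
have px : psi4 (phi d) = x by rewrite psi4E -sx s4.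
have hpp : phi (psi4 (phi d)) = psi4 d by rewrite px phiE aK psi4E.
split=> //; split=> //; last by rewrite px.
  have hlgg : large (phi (phi d)) by rewrite large_phi.
  (* With degree 3 there, the triangle across [phi (phi d)] would have the same apex and be followed
     by the large face at [x]. *)
  case: (large_dg hlgg) => // d3.
  have t3 := apex_tri3 m1 d3; have [_ _ x3] := large4 hx dx.
  have := apex_next3 m1 d3; rewrite -sx x3 => /esym h3.
  case/negP: (apex_next_small hlgg h3).
  by rewrite qE -t3 aK -sx s4.
by rewrite -sx dg_s.
Qed.

(* The far end of the third edge at [d] lies on a second large face. *)
Definition rung3 d :=
  [/\ dg d = 3, L (s d) = 4, L (s (s d)) = 4, dg (q d) = 3 & large (psi3 d)]%N.

(** In the quadrilateral across [d], the side opposite [d] borders the second large face and ends at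
    the vertex of [q (phi d)]. *)
Lemma rung3_step d : large d -> rung3 d ->
  rung3 (phi d) /\ phi (psi3 (phi d)) = psi3 d.
Proof.
move=> hl [hd h1 h2 hq hX]; have hlg : large (phi d) by rewrite large_phi.
pose x := a (s (q d)).
have hx : large x by rewrite /large -L_s -psi3E.
have quad : s (a (s x)) = a d.
  have := iter_L (s d); rewrite h1 /= [phi (s d)]phiE -(qE d) [phi (s _)]phiE -/x.
  by rewrite -(phiaE d) => /perm_inj; rewrite phiE.
have ssad : s (a d) = phi d by rewrite phiE.
have Lad : L (a d) = 4%N by rewrite -L_s h1.
have dgg : dg (phi d) = 3%N.
  case: (large_dg hlg) => // d4; have [_ _] := large4 hlg d4.
  have -> : s (s (s (phi d))) = a d by apply: s_inj; rewrite s4 // ssad.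
  by rewrite Lad.
have ssg : s (s (phi d)) = a d by apply: s_inj; rewrite s3 // ssad.
have sx : s x = q (phi d).
  by rewrite qE; apply: a_inj; rewrite aK; apply: s_inj; rewrite quad ssg.
have Lsx : L (s x) = 4%N by rewrite sx L_q ssg.
have dx : dg x = 3%N.
  by case: (large_dg hx) => // d4; have [] := large4 hx d4; rewrite Lsx.
have px : psi3 (phi d) = x by rewrite psi3E -sx s3.
split; last by rewrite px phiE aK psi3E.
split=> //; rewrite ?ssg ?px //; last by rewrite -sx dg_s.
have : L (s (phi d)) = 3%N \/ L (s (phi d)) = 4%N.
  have : L (s (s (phi d))) = 4%N by rewrite ssg.
  by case: (largeP hlg) => //; [left|right].
case=> // h; case/negP: (apex_next_small hlg h).
by rewrite -sx s3.
Qed.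

Lemma s_a_sigma d0 d : d \in porbit phi d0 -> a d \in porbit s (phi d).
Proof. by move=> hd; rewrite -s_porbit -phiE porbit_id. Qed.

(** One rung forces the next all around the face, and the resulting ladder is the whole map, an
    antiprism. *)
Lemma no_rung4 d0 : large d0 -> ~ is_antiprism s a -> ~ rung4 d0.
Proof.
move=> hl nanti h0.
have all_rung d : d \in porbit phi d0 -> rung4 d.
  move: d; apply: sigma_ind => // d hd /rung4_step[] //.
  exact: large_sigma hd.
have step d : d \in porbit phi d0 -> phi (psi4 (phi d)) = psi4 d.
  by move=> hd; have [] := rung4_step (large_sigma hl hd) (all_rung d hd).
have a_psi d : d \in porbit phi d0 -> a (psi4 (phi d)) = s (s (q d)).
  by move=> hd; apply: s_inj; rewrite -phiE step // psi4E.
have dgs d : d \in porbit phi d0 -> dg d = 4%N by move=> /all_rung[].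
have dgq d : d \in porbit phi d0 -> dg (q d) = 4%N by move=> /all_rung[].
have L4 d : d \in porbit phi d0 ->
    [/\ L (s d) = 3, L (s (s d)) = 3 & L (s (s (s d))) = 3]%N.
  by move=> hd; apply: large4 (dgs d hd); apply: large_sigma hd.
have L_s_sigma d : d \in porbit phi d0 ->
    forall x, x \in porbit s d -> x != d -> L x = 3%N.
  move=> hd x /(in_porbit4 (dgs d hd)) hx; have [] := L4 d hd.
  by case: hx => ->; rewrite ?eqxx.
have L_s_psi d : d \in porbit phi d0 ->
    forall x, x \in porbit s (psi4 d) -> x != psi4 d -> L x = 3%N.
  move=> hd x; rewrite porbit_psi4 => /(in_porbit4 (dgq d hd)) hx.
  have [h1 h2 h3] := L4 d hd; have hgd : phi d \in porbit phi d0 by rewrite phi_sigma.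
  have [m1 m2 m3] := L4 (phi d) hgd.
  case: hx => ->; rewrite ?psi4E ?eqxx ?L_q ?L_sq //.
  by rewrite apex_next4 // dgs.
have Ks d : d \in porbit phi d0 -> K d = r d.
  move=> hd; rewrite (K4 (dgs d hd)).
  by have [/r_eq -> /r_eq -> /r_eq ->] := L4 d hd; lra.
have on_a x : on_ladder d0 psi4 x -> on_ladder d0 psi4 (a x).
  case=> d hd; have [d' hd' dE] := phi_pred hd.
  have hgd : phi d \in porbit phi d0 by rewrite phi_sigma.
  have ad' : a d' = s (s (s d)) by apply: s_inj; rewrite s4 ?dgs // dE phiE.
  have tri := apex_tri4 (let: And3 h _ _ := L4 _ hd' in h).
  rewrite porbit_psi4.
  case=> [/(in_porbit4 (dgs d hd))|/(in_porbit4 (dgq d hd))] [] ->.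
  - by exists (phi d) => //; left; apply: s_a_sigma hd.
  - by exists d => //; right; rewrite porbit_psi4 -qE porbit_id.
  - exists d' => //; right; rewrite porbit_psi4 dE -tri ?aK; last by rewrite -dE dgs.
    by rewrite s_porbit porbit_id.
  - by exists d' => //; left; rewrite -ad' aK porbit_id.
  - by exists d => //; left; rewrite qE aK s_porbit porbit_id.
  - exists (phi d) => //; left; rewrite apex_tri4 ?dgs ?s_porbit ?porbit_id //.
    by case: (L4 d hd).
  - by exists (phi d) => //; right; rewrite -a_psi // aK porbit_id.
  - exists d' => //; right; rewrite -psi4E dE a_psi // porbit_psi4.
    by rewrite !s_porbit porbit_id.
have dgp d : d \in porbit phi d0 -> dg (psi4 d) = 4%N.
  by move=> hd; rewrite psi4E !dg_s dgq.
have [h1 h2 [h3 h4] h5 h6] :=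
  ladderP hl (isT : 3 <= 41)%N (isT : 0 < 4)%N dgs dgp step Ks L_s_sigma L_s_psi on_a.
by apply: nanti; exists (L d0), d0, (psi4 d0); split=> //; split=> //; lia.
Qed.

Lemma no_rung3 d0 : large d0 -> ~ is_prism s a -> ~ rung3 d0.
Proof.
move=> hl nprism h0.
have all_rung d : d \in porbit phi d0 -> rung3 d.
  move: d; apply: sigma_ind => // d hd /rung3_step[] //.
  exact: large_sigma hd.
have step d : d \in porbit phi d0 -> phi (psi3 (phi d)) = psi3 d.
  by move=> hd; have [] := rung3_step (large_sigma hl hd) (all_rung d hd).
have a_psi d : d \in porbit phi d0 -> a (psi3 (phi d)) = s (q d).
  by move=> hd; apply: s_inj; rewrite -phiE step // psi3E.
have dgs d : d \in porbit phi d0 -> dg d = 3%N by move=> /all_rung[].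
have dgq d : d \in porbit phi d0 -> dg (q d) = 3%N by move=> /all_rung[].
have L1 d : d \in porbit phi d0 -> L (s d) = 4%N by move=> /all_rung[].
have L2 d : d \in porbit phi d0 -> L (s (s d)) = 4%N by move=> /all_rung[].
have L_s_sigma d : d \in porbit phi d0 ->
    forall x, x \in porbit s d -> x != d -> L x = 4%N.
  move=> hd x /(in_porbit3 (dgs d hd)) hx.
  by case: hx => ->; rewrite ?eqxx ?(L1 d hd) ?(L2 d hd).
have L_s_psi d : d \in porbit phi d0 ->
    forall x, x \in porbit s (psi3 d) -> x != psi3 d -> L x = 4%N.
  move=> hd x; rewrite porbit_psi3 => /(in_porbit3 (dgq d hd)) hx.
  by case: hx => ->; rewrite ?psi3E ?eqxx ?L_q ?L_sq ?(L1 d hd) ?(L2 d hd).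
have Ks d : d \in porbit phi d0 -> K d = r d.
  by move=> hd; rewrite (K3 (dgs d hd)) (r_eq (L1 d hd)) (r_eq (L2 d hd)); lra.
have on_a x : on_ladder d0 psi3 x -> on_ladder d0 psi3 (a x).
  case=> d hd; have [d' hd' dE] := phi_pred hd.
  have hgd : phi d \in porbit phi d0 by rewrite phi_sigma.
  have ad' : a d' = s (s d) by apply: s_inj; rewrite s3 ?dgs // dE phiE.
  rewrite porbit_psi3.
  case=> [/(in_porbit3 (dgs d hd))|/(in_porbit3 (dgq d hd))] [] ->.
  - by exists (phi d) => //; left; apply: s_a_sigma hd.
  - by exists d => //; right; rewrite porbit_psi3 -qE porbit_id.
  - by exists d' => //; left; rewrite -ad' aK porbit_id.
  - by exists d => //; left; rewrite qE aK s_porbit porbit_id.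
  - by exists (phi d) => //; right; rewrite -a_psi // aK porbit_id.
  - exists d' => //; right; rewrite -psi3E dE a_psi // porbit_psi3.
    by rewrite s_porbit porbit_id.
have dgp d : d \in porbit phi d0 -> dg (psi3 d) = 3%N.
  by move=> hd; rewrite psi3E !dg_s dgq.
have [h1 h2 [h3 h4] h5 h6] :=
  ladderP hl (isT : 4 <= 41)%N (isT : 0 < 3)%N dgs dgp step Ks L_s_sigma L_s_psi on_a.
by apply: nprism; exists (L d0), d0, (psi3 d0); split=> //; split=> //; lia.
Qed.

(** * Discharging *)

(* The discharging rules are written for a triangle with an edge [d] on the
   large face.  An end of [d] is described by its degree [k] and by the length
   [x] of the other neighbour of the large face there; [c] is the curvature of
   the apex of the triangle.  Writing A, B, C, D for the ends of degree 3 with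
   x = 3, 4, 5, 6, each end wants to keep 1/41 on top of the curvature 1/N: A
   and B can spare 1/41 per triangle, C can spare 1/30 - 1/41, D needs 1/41. *)
Definition own (x : nat) : rat :=
  match x with
  | 3 | 4 => - 1/41
  | 5 => 1/41 - 1/30
  | 6 => 1/41
  | _ => 0
  end.

(* What an end of degree 4 receives when the other end is ([k], [x]): the shares
   of A, B, C, topped up from the apex by 1/105 for C; whatever the apex can
   afford after paying D; half of the apex if both ends have degree 4. *)
Definition recv (k x : nat) (c : rat) : rat :=
  if k == 4%N then Num.min c (1/30) / 2 else
  match x with
  | 3 | 4 => 1/41
  | 5 => 1/30 - 1/41 + 1/105
  | 6 => Num.min c (1/41 + 1/60) - 1/41
  | _ => 0
  end.

Definition gift (k x k' x' : nat) (c : rat) : rat :=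
  if k == 4%N then recv k' x' c else own x.

Definition giftL d : rat :=
  if L (s d) == 3%N then
    gift (dg d) (L (s (s d))) (dg (phi d)) (L (s (s (q d)))) (K (q d))
  else 0.
Definition giftR d : rat :=
  if L (s d) == 3%N then
    gift (dg (phi d)) (L (s (s (q d)))) (dg d) (L (s (s d))) (K (q d))
  else 0.
(* The vertex across a degree-3 vertex between two quadrilaterals pays for it. *)
Definition claimQ d : rat :=
  if [&& dg d == 3, L (s d) == 4 & L (s (s d)) == 4]%N then 1/41 else 0.
(* In the pattern 6,3,(3),3,6 around the large face with both apexes of type
   (3,3,6,5) the apexes do not suffice; the vertex following an apex on the edge
   between its hexagon and its pentagon has curvature at least 1/105. *)
Definition claimZ d : rat :=
  if [&& dg d == 4%N, dg (phi d) == 3%N, L (s (s (q d))) == 6%N & K (q d) < 1/12]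
  then 1/105 else 0.

Hypothesis nprism : ~ is_prism s a.
Hypothesis nantiprism : ~ is_antiprism s a.

(** With degree 4 the curvature is the reciprocal of the fourth length, at most 41 because the map
    is no antiprism. With degree 5 the least value is 1/30, at (3,3,3,3,5). *)
Lemma apex333 g : large g -> dg g = 4%N -> dg (phi g) = 4%N ->
  1/41 <= K (q g) /\ (dg (q g) = 4%N -> ~~ large (s (s (s (q g))))).
Proof.
move=> hl hg hh; have [l1 l2 _] := large4 hl hg.
have hlh : large (phi g) by rewrite large_phi.
have [_ m2 _] := large4 hlh hh.
have h0 : L (q g) = 3%N by rewrite L_q.
have h1 : L (s (q g)) = 3%N by rewrite L_sq.
have h2 : L (s (s (q g))) = 3%N by rewrite apex_next4.
have hs : dg (q g) = 4%N -> ~~ large (s (s (s (q g)))).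
  move=> h4; apply/negP => hX; apply: (@no_rung4 g) => //.
  by split; rewrite ?psi4E.
split; last exact: hs.
move/r_eq: h0 => h0; move/r_eq: h1 => h1; move/r_eq: h2 => h2.
have := Kpos (q g).
case: (dgP (q g)) => hd; first by rewrite (K3 hd); lra.
  by have := r_small (hs hd); rewrite (K4 hd); lra.
rewrite (K5 hd) h0 h1 h2.
case: (lenP (s (s (s (q g))))) => _; case: (lenP (s (s (s (s (q g)))))) => _ *; lra.
Qed.

Lemma no_large_quad g : large g -> dg g = 3%N -> L (s g) = 4%N -> L (s (s g)) = 4%N ->
  dg (q g) = 3%N -> ~~ large (s (s (q g))).
Proof.
move=> hl hg h1 h2 hq; apply/negP => hX; apply: (@no_rung3 g) => //.
by split; rewrite ?psi3E.
Qed.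

Lemma a_pred3 d : dg (phi d) = 3%N -> a d = s (s (phi d)).
Proof. by move=> h; apply: s_inj; rewrite s3 // phiE. Qed.

Lemma a_pred4 d : dg (phi d) = 4%N -> a d = s (s (s (phi d))).
Proof. by move=> h; apply: s_inj; rewrite s4 // phiE. Qed.

Lemma claimZ_ge0 d : 0 <= claimZ d.
Proof. by rewrite /claimZ; case: ifP => _; lra. Qed.

Lemma charge3 d : large d -> dg (phi d) = 3%N ->
  r (phi d) + 1/41 <= K (phi d) + giftL (phi d) + giftR d + claimQ (phi d) + claimZ (phi d).
Proof.
move=> hl; set g := phi d => hg; have hlg : large g by rewrite large_phi.
have := claimZ_ge0 g.
have -> : giftR d = if L (s (s g)) == 3%N then own (L (s g)) else 0.
  have e : L (s d) = L (s (s g)) by rewrite L_s a_pred3.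
  rewrite /giftR /gift -/g hg e; case: eqP => // h3.
  by rewrite apex_next3 // e.
rewrite (K3 hg) /giftL /claimQ /gift hg.
have := r_eq (erefl (L (s g))); have := r_eq (erefl (L (s (s g)))).
by case: (largeP hlg) => /= -> -> *; lra.
Qed.

(** A triangle yields at least [1/30 - 1/41], and [2/41 - 1/30] completes this to 1/41. The other
    two alternatives are the poor sides, which [charge4] has to combine pairwise. *)
Lemma recv_ge k x c :
  k = 4%N /\ 1/41 <= c \/ k = 3%N /\ [\/ x = 3, x = 4, x = 5 | x = 6]%N ->
  (x = 6%N -> 1/30 <= c) ->
  1/30 - 1/41 <= recv k x c /\
  [\/ 2/41 - 1/30 <= recv k x c,
      [/\ k = 4%N, 1/82 <= recv k x c & (1/30 <= c -> 1/60 <= recv k x c)]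
    | [/\ k = 3%N, x = 6%N & c < 1/12]].
Proof.
case=> [[-> hc] _|[-> hx] h6]; rewrite /recv /=.
  have h : 1/82 <= Num.min c (1/30) / 2 by case: (leP c (1/30)) => ?; lra.
  split; [lra|apply: Or32]; split=> [|//|h30]; first by [].
  by case: (leP c (1/30)) => ?; lra.
case: hx h6 => -> h6; try (by split; [lra|apply: Or31; lra]).
have h30 := h6 erefl.
have [lt|ge] := ltP c (1/12); split.
- by case: (leP c (1/41 + 1/60)) => ?; lra.
- by apply: Or33; split; [reflexivity|reflexivity|by []].
- by case: (leP c (1/41 + 1/60)) => ?; lra.
- by apply: Or31; case: (leP c (1/41 + 1/60)) => ?; lra.
Qed.

Lemma charge4 d : large d -> dg (phi d) = 4%N ->
  r (phi d) + 1/41 <= K (phi d) + giftL (phi d) + giftR d + claimQ (phi d) + claimZ (phi d).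
Proof.
move=> hl; set g := phi d => hg; have hlg : large g by rewrite large_phi.
have [l1 l2 l3] := large4 hlg hg.
have L1 : L (s d) = 3%N by rewrite L_s a_pred4.
have Lqd : L (s (s (q d))) = 3%N by rewrite apex_next4.
pose x := a (s (s (q d))).
have sx : s x = q g by apply: apex_mid.
have Lx : L x = L (s (s (s (q d)))) by rewrite [RHS]L_s.
have Kg : K g = r g.
  by rewrite (K4 hg) (r_eq l1) (r_eq l2) (r_eq l3); lra.
have Lqg : L (q g) = 3%N by rewrite L_q.
have Lsqg : L (s (q g)) = 3%N by rewrite L_sq.
have hlh : large (phi g) by rewrite large_phi.
have right : dg (phi g) = 4%N /\ 1/41 <= K (q g) \/
  dg (phi g) = 3%N /\ [\/ L (s (s (q g))) = 3, L (s (s (q g))) = 4,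
     L (s (s (q g))) = 5 | L (s (s (q g))) = 6]%N.
  case: (large_dg hlh) => hh; [right|left]; (split; first exact: hh).
    have : L (s (s (phi g))) = 3%N by rewrite -a_pred3 // -L_s.
    rewrite apex_next3 //; case: (largeP hlh) => // _;
      first [exact: Or41|exact: Or42|exact: Or43|exact: Or44].
  by have [] := apex333 hlg hg hh.
have left : dg d = 4%N /\ 1/41 <= K (q d) \/
  dg d = 3%N /\ [\/ L (s (s d)) = 3, L (s (s d)) = 4,
     L (s (s d)) = 5 | L (s (s d)) = 6]%N.
  case: (large_dg hl) => hh; [right|left]; (split; first exact: hh).
    by move: L1; case: (largeP hl) => // _;
      first [exact: Or41|exact: Or42|exact: Or43|exact: Or44].
  by have [] := apex333 hl hh hg.
(* If the right apex has type (3,3,6,5), its pentagon lies across the edge joining both apexes, so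
   the left apex sees 3,3,3,5. *)
have rightD : L (s (s (q g))) = 6%N -> 1/30 <= K (q g) /\
    (K (q g) < 1/12 -> dg d = 4%N -> 1/30 <= K (q d)).
  move=> h6; have [h30 h12] := apex336 Lqg Lsqg h6; split; first exact: h30.
  move=> /h12[h4 h5] hd.
  have [_ m2 _] := large4 hl hd.
  have e : L (s (s (s (q d)))) = 5%N.
    have dx : dg x = 4%N by rewrite -dg_s sx.
    by rewrite -Lx -h5 -sx (s4 dx).
  exact: apex3335 (etrans (L_q d) m2) (etrans (L_sq d) L1) Lqd e.
have leftD : L (s (s d)) = 6%N -> 1/30 <= K (q d) /\
    (K (q d) < 1/12 -> dg (phi g) = 4%N -> 1/30 <= K (q g)).
  move=> h6; have h0 : L (q d) = 6%N by rewrite L_q.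
  have h1 : L (s (q d)) = 3%N by rewrite L_sq.
  have [h30 h12] := apex633 h0 h1 Lqd; split; first exact: h30.
  move=> /h12[_ h5] hh.
  have [_ m2 _] := large4 hlh hh.
  have e : L (s (s (s x))) = 3%N by rewrite sx apex_next4.
  rewrite -sx K_s; apply: apex5333 e.
  - by rewrite Lx.
  - by rewrite sx.
  - by rewrite sx.
have [wR sR] := recv_ge right (fun h => (rightD h).1).
have [wL sL] := recv_ge left (fun h => (leftD h).1).
have hZ := claimZ_ge0 g.
rewrite Kg /giftL /giftR /claimQ /gift l1 L1 -/g hg /= addr0.
case: sR => [?|[eR mR mR']|[eR xR ltR]]; first by lra.
  case: sL => [?|[eL mL _]|[eL xL ltL]]; [by lra|by lra|].
  by have := mR' ((leftD xL).2 ltL eR); lra.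
case: sL => [?|[eL mL mL']|[eL xL ltL]]; first by lra.
  by have := mL' ((rightD xR).2 ltR eL); lra.
(* Both outer ends are of type D with poor apexes; two minimal receipts and 1/105 together exceed
   1/41. *)
have -> : claimZ g = 1/105 by rewrite /claimZ hg eR xR ltR.
by lra.
Qed.

(* Upper bound for the amount claimed through a dart, in terms of the lengths of
   the faces at it and at the next two darts, and of the curvature [c]. *)
Definition crude (c : rat) (x y w : nat) : rat :=
  match x, y, w with
  | 3, 3, 3 => Num.min c (1/30)
  | 3, 3, 5 | 5, 3, 3 => 1/105
  | 3, 3, 6 | 6, 3, 3 => Num.min c (1/41 + 1/60)
  | 5, 3, 6 | 6, 3, 5 => 2/41 - 1/30
  | 6, 3, 6 => 2/41
  | 4, 4, _ => 1/41
  | 5, 6, _ => 1/105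
  | _, _, _ => 0
  end.

Lemma crude_ge0 c x y w : 0 < c -> 0 <= crude c x y w.
Proof.
move=> c0.
have m1 : 0 <= Num.min c (1/30) by case: (leP c (1/30)) => ?; lra.
have m2 : 0 <= Num.min c (1/41 + 1/60) by case: (leP c (1/41 + 1/60)) => ?; lra.
have [e0 e1 e2 e3 e4] : [/\ (0 <= 0 :> rat), (0 <= 1/105 :> rat), (0 <= 1/41 :> rat),
  (0 <= 2/41 :> rat) & (0 <= 2/41 - 1/30 :> rat)] by split; lra.
rewrite /crude.
repeat (match goal with |- context [match ?n with _ => _ end] => destruct n end);
  lazymatch goal with H : ?A |- ?A => exact H end.
Qed.

Lemma neighbours d : large d -> L (s d) = 3%N ->
  (dg d = 4%N /\ L (q d) = 3%N \/
   dg d = 3%N /\ [\/ L (q d) = 3, L (q d) = 4, L (q d) = 5 | L (q d) = 6]%N) /\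
  (dg (phi d) = 4%N /\ L (s (s (q d))) = 3%N \/
   dg (phi d) = 3%N /\ [\/ L (s (s (q d))) = 3, L (s (s (q d))) = 4,
     L (s (s (q d))) = 5 | L (s (s (q d))) = 6]%N).
Proof.
move=> hl h; have hlg : large (phi d) by rewrite large_phi.
split.
  rewrite L_q; case: (large_dg hl) => hd; [right|left]; (split; first exact: hd).
    by move: h; case: (largeP hl) => // _;
      first [exact: Or41|exact: Or42|exact: Or43|exact: Or44].
  by have [] := large4 hl hd.
case: (large_dg hlg) => hd; [right|left]; (split; first exact: hd).
  have : L (s (s (phi d))) = 3%N by rewrite -a_pred3 // -L_s.
  rewrite apex_next3 //; case: (largeP hlg) => // _;
    first [exact: Or41|exact: Or42|exact: Or43|exact: Or44].
by rewrite apex_next4 //; have [] := large4 hlg hd.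
Qed.

Lemma gifts_le d : large d -> L (s d) = 3%N ->
  giftL d + giftR d <= crude (K (q d)) (L (q d)) 3 (L (s (s (q d)))).
Proof.
move=> hl h; have c0 := Kpos (q d).
rewrite /giftL /giftR h eqxx -L_q /gift.
case: (neighbours hl h) => -[[-> hL]|[-> hL]] [[-> hR]|[-> hR]]; rewrite /recv /=.
- rewrite hL hR /=; case: (leP (K (q d)) (1/30)) => ?; lra.
- rewrite hL; case: hR => -> /=; case: (leP (K (q d)) (1/30)) => ?; lra.
- rewrite hR; case: hL => -> /=; case: (leP (K (q d)) (1/30)) => ?; lra.
- by case: hR => ->; case: hL => -> /=; case: (leP (K (q d)) (1/30)) => ?;
    case: (leP (K (q d)) (1/41 + 1/60)) => ?; lra.
Qed.

(* An end of type A pays 1/41, which covers every possible need of the other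
   end; so an adjacent triangle at a paying apex comes from an end of degree 4. *)
Lemma gifts_gt0 d : large d -> L (s d) = 3%N -> 0 < giftL d + giftR d ->
  (L (q d) = 3%N -> dg d = 4%N) /\ (L (s (s (q d))) = 3%N -> dg (phi d) = 4%N).
Proof.
move=> hl h; rewrite /giftL /giftR h eqxx -L_q /gift.
case: (neighbours hl h) => -[[-> hL]|[-> hL]] [[-> hR]|[-> hR]]; rewrite /recv /=.
- by move=> _; split.
- rewrite hL; case: hR => -> /= H; (split=> e; first [reflexivity|discriminate e|absurd_lra]).
- rewrite hR; case: hL => -> /= H; (split=> e; first [reflexivity|discriminate e|absurd_lra]).
- by case: hR => ->; case: hL => -> /= H;
    (split=> e; first [reflexivity|discriminate e|absurd_lra]).
Qed.

(* [z d] starts at the far end of the edge between the hexagon and the pentagon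
   in the situation of [claimZ]. *)
Definition z : {perm D} := (q * s * s * a)%g.
Lemma zE d : z d = a (s (s (q d))). Proof. by rewrite !permM. Qed.

Lemma claimZ_neq0 d : large d -> claimZ d != 0 ->
  [/\ dg d = 4, dg (phi d) = 3, L (s d) = 3, L (s (s (q d))) = 6
    & L (z d) = 5 /\ L (s (z d)) = 6]%N.
Proof.
move=> hl; rewrite /claimZ; case: ifP => [|_]; last by rewrite eqxx.
case/and4P => /eqP h1 /eqP h2 /eqP h3 hK _.
have [l1 l2 _] := large4 hl h1.
have [_ /(_ hK)[_ h5]] := apex336 (etrans (L_q d) l2) (etrans (L_sq d) l1) h3.
by rewrite [L (s (z d))]L_s zE aK -L_s.
Qed.

(** * Claims on the vertices near a large face *)

Section Claims.
Variable d0 : D.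
Local Notation sigma := (porbit phi d0).
Hypothesis large0 : large d0.

(* [cl e] is the total amount claimed from the vertex of [e] through [e]. *)
Definition clT e : rat :=
  let d := (q^-1)%g e in
  if d \in sigma then giftL d + giftR d + claimQ d else 0.
Definition clZ e : rat :=
  let d := (z^-1)%g e in if d \in sigma then claimZ d else 0.
Definition cl e : rat := clT e + clZ e.

Lemma clTP e : clT e = 0 \/
  exists d, [/\ large d, e = q d & clT e = giftL d + giftR d + claimQ d].
Proof.
rewrite /clT; case: ifP => [h|]; last by left.
right; exists ((q^-1)%g e); split; [|by rewrite permKV|by []].
exact: large_sigma h.
Qed.

Lemma clZP e : clZ e = 0 \/
  exists d, [/\ large d, e = z d, clZ e = claimZ d & claimZ d != 0].
Proof.
rewrite /clZ; case: ifP => [h|]; last by left.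
have [->|h0] := eqVneq (claimZ ((z^-1)%g e)) 0; first by left.
right; exists ((z^-1)%g e); split; [|by rewrite permKV|by []|exact: h0].
exact: large_sigma h.
Qed.

Lemma clZ_len e : clZ e = 0 \/ L e = 5%N /\ L (s e) = 6%N.
Proof.
case: (clZP e) => [->|[d [hl -> _ /(claimZ_neq0 hl)[_ _ _ _ [h5 h6]]]]]; first by left.
by right.
Qed.

Lemma claimZ_le d : claimZ d <= 1/105.
Proof. by rewrite /claimZ; case: ifP => _; lra. Qed.

Lemma gifts_tri d : L (s d) = 3%N -> claimQ d = 0.
Proof. by move=> h; rewrite /claimQ h andbF. Qed.

Lemma gifts_ntri d : L (s d) <> 3%N -> giftL d + giftR d = 0.
Proof. by rewrite /giftL /giftR => /eqP/negPf ->; rewrite addr0. Qed.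

(** The two kinds of claims never share a dart: [clZ] acts between a pentagon and a hexagon, [clT]
    at a triangle or between quadrilaterals. *)
Lemma cl_le e : cl e <= crude (K e) (L e) (L (s e)) (L (s (s e))).
Proof.
have c0 := crude_ge0 (L e) (L (s e)) (L (s (s e))) (Kpos e).
rewrite /cl; case: (clZ_len e) => [->|[h5 h6]].
  rewrite addr0; case: (clTP e) => [->|[d [hl eE ->]]]; first exact: c0.
  move: c0; rewrite eE L_sq; have [h3|/eqP h3] := eqVneq (L (s d)) 3%N.
    by move=> _; rewrite (gifts_tri h3) addr0 h3; apply: gifts_le.
  rewrite gifts_ntri; last exact: h3.
  rewrite add0r /claimQ; case: ifP => [/and3P[_ /eqP -> /eqP h2] _|_ c0].
    by rewrite L_q h2 /=; apply: lexx.
  exact: c0.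
have cZ : clZ e <= 1/105.
  by case: (clZP e) => [->|[d [_ _ -> _]]]; [lra|exact: claimZ_le].
rewrite h5 h6 /=; case: (clTP e) => [->|[d [hl eE ->]]]; first by rewrite add0r; exact: cZ.
have h : L (s d) = 6%N by rewrite -L_sq -eE.
rewrite gifts_ntri; last by rewrite h.
rewrite /claimQ h andbF !add0r; exact: cZ.
Qed.

Lemma cl_tri e : L (s e) = 3%N -> 0 < cl e ->
  exists d, [/\ large d, e = q d, L (s d) = 3%N, (L e = 3%N -> dg d = 4%N)
    & (L (s (s e)) = 3%N -> dg (phi d) = 4%N)].
Proof.
move=> h3; rewrite /cl; have -> : clZ e = 0.
  by case: (clZ_len e) => // -[_]; rewrite h3.
rewrite addr0; case: (clTP e) => [->|[d [hl eE ->]]]; first by rewrite ltxx.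
have hd : L (s d) = 3%N by rewrite -L_sq -eE.
rewrite gifts_tri // addr0 => /(gifts_gt0 hl hd)[h1 h2].
by exists d; split; rewrite // eE.
Qed.

(* If the left or right end of a paying triangle has degree 4, the adjacent
   triangle at the apex has a single corner on the large face, so it cannot be a
   paying triangle itself. *)
Lemma cl_adj e : L (s e) = 3%N -> L (s (s e)) = 3%N -> 0 < cl e -> 0 < cl (s e) -> False.
Proof.
move=> h1 h2 /(cl_tri h1)[d [hl eE hd _ hR]] /(cl_tri h2)[d' [hl' eE' _ hL _]].
have hg := hR h2; have := apex_tri4 hd hg.
rewrite -eE eE' qE aK => /s_inj hd'.
have hlg : large (phi d) by rewrite large_phi.
by have [] := large4 hlg hg; rewrite -hd' => h; move: hl'; rewrite /large h.
Qed.

(** The middle triangle makes the vertex of [d'] the apex over [phi d], with the large face of [d']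
    right after the triangle, against [apex_next_small]. *)
Lemma cl_dist2 e : L (s e) = 3%N -> L (s (s e)) = 3%N -> L (s (s (s e))) = 3%N ->
  0 < cl e -> 0 < cl (s (s e)) -> False.
Proof.
move=> h1 h2 h3 /(cl_tri h1)[d [hl eE hd _ hR]] /(cl_tri h3)[d' [hl' eE' hd' hL _]].
have hg := hR h2; have hg' := hL h2.
have hlg : large (phi d) by rewrite large_phi.
have [m1 m2 _] := large4 hlg hg.
have := apex_mid hd hg m2; rewrite -eE eE' qE aK => e1.
case/negP: (apex_next_small hlg m1).
by rewrite -e1 s4.
Qed.

(* If the claimed vertex were also an apex, the hexagon would meet the large
   face in two edges and force an apex onto the large face. *)
Lemma cl_pent e : L e = 5%N -> L (s e) = 6%N -> L (s (s e)) = 3%N -> clZ e != 0 ->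
  0 < cl (s e) -> False.
Proof.
move=> h0 h1 h2; case: (clZP e) => [->|[d [hl eE _ hZ]]]; first by rewrite eqxx.
move=> _ /(cl_tri h2)[d' [hl' eE' hd' _ _]].
have [dd dg3 hd h6 _] := claimZ_neq0 hl hZ.
set g := phi d in dg3; have hlg : large g by rewrite large_phi.
have Lsg : L (s g) = 6%N by rewrite -apex_next3.
have hex : iter 6 phi (a g) = a g.
  by rewrite -[RHS]iter_L -L_s Lsg.
have Lssd' : L (s (s d')) = 6%N by rewrite -L_q -eE'.
have dgd' : dg d' = 3%N.
  by case: (large_dg hl') => // h4; have [_] := large4 hl' h4; rewrite Lssd'.
pose g' := (phi^-1)%g d'.
have g'E : phi g' = d' by rewrite permKV.
have hlg' : large g' by rewrite -large_phi g'E.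
have ag' : a g' = s (s d') by apply: s_inj; rewrite s3 // -phiE.
(* The sides of the hexagon are, in order, [a g], [s g], [s (s (q d))], [s e], [a g'], [s g']. *)
have close : phi (s g') = a g.
  rewrite -[RHS]hex /= phiaE !phiE.
  have -> : a (s g) = s (q d) by rewrite -apex_tri3 // aK.
  by rewrite -zE -eE eE' qE aK -ag' aK.
have Lsg' : L (s g') = 6%N by rewrite -L_phi close -L_s.
have dgg' : dg g' = 3%N.
  by case: (large_dg hlg') => // h4; have [] := large4 hlg' h4; rewrite Lsg'.
set k := phi g; have hlk : large k by rewrite large_phi.
have sag : s (a g) = k by rewrite -phiE.
have Lag : L (a g) = 6%N by rewrite -L_s.
have dgk : dg k = 3%N.
  case: (large_dg hlk) => // h4; have [_ _] := large4 hlk h4.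
  by rewrite -(a_pred4 h4) Lag.
have ssk : s (s k) = a g by rewrite -a_pred3.
have Lsk : L (s k) = 3%N.
  by have : L (s (s k)) = 6%N; [rewrite ssk|case: (largeP hlk)].
have qk : q k = s g'.
  rewrite qE; apply: a_inj; rewrite aK; apply: s_inj.
  by rewrite ssk -close phiE.
(* The apex over [k] is the vertex of [g'], whose large face follows the triangle. *)
case/negP: (apex_next_small hlk Lsk).
by rewrite qk s3.
Qed.

(** * Curvature against claims at a single vertex *)

Variant len_cases : nat -> rat -> Prop :=
  | LenCase3 : len_cases 3 (1/3)
  | LenCase4 : len_cases 4 (1/4)
  | LenCase5 : len_cases 5 (1/5)
  | LenCase6 : len_cases 6 (1/6)
  | LenCase7 : len_cases 7 (1/7)
  | LenCase8 m x of 0 < x <= 1/8 : len_cases m.+4.+4 x.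

(** Unlike with [lenP], the length itself becomes a numeral or [m.+4.+4], so that [crude]
    reduces. *)
Lemma len_casesP d : len_cases (L d) (r d).
Proof.
case: (lenP d) => [-> ->|-> ->|-> ->|-> ->|-> ->|h hr]; try by constructor.
rewrite (_ : L d = (L d - 8).+4.+4); first exact: LenCase8.
exact: esym (subnKC h).
Qed.

Ltac order_prune H := try (vm_compute in H; discriminate H).

Lemma min_bounds (x y : rat) : Num.min x y <= x /\ Num.min x y <= y.
Proof. by rewrite !ge_min !lexx orbT. Qed.

(** The longest face comes first, to cut down the cases. The bound is tight at (41,4,4) with 1/41
    and at (7,5,6) with 1/105. *)
Lemma budget3 (k r0 r1 r2 : rat) n0 n1 n2 (c0 c1 c2 : rat) :
  len_cases n0 r0 -> len_cases n1 r1 -> len_cases n2 r2 ->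
  (n1 <= n0)%N -> (n2 <= n0)%N -> 1/41 <= r0 ->
  0 < k -> k = r0 + r1 + r2 - 1/2 ->
  c0 <= crude k n0 n1 n2 -> c1 <= crude k n1 n2 n0 -> c2 <= crude k n2 n0 n1 ->
  c0 + c1 + c2 <= k.
Proof.
move=> h0 h1 h2 o1 o2 small k0 kE; have hk : 1/2 < r0 + r1 + r2 by lra.
move: small k0 kE.
case: h0 hk o1 o2 => [|||||? ? ?] hk o1 o2;
case: h1 hk o1 => [|||||? ? ?] hk o1; order_prune o1; clear o1;
case: h2 hk o2 => [|||||? ? ?] hk o2; order_prune o2; clear o2; try absurd_lra; clear hk;
have [_ m1] := min_bounds k (1/30); have [_ m2] := min_bounds k (1/41 + 1/60);
rewrite /= => *; lra.
Qed.

(** The last three hypotheses serve the types (6,3,3,5) and (6,5,3,3), of curvature 1/30, where the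
    bounds from [crude] alone add up to more. *)
Lemma budget4 (k r0 r1 r2 r3 : rat) n0 n1 n2 n3 (c0 c1 c2 c3 : rat) :
  len_cases n0 r0 -> len_cases n1 r1 -> len_cases n2 r2 -> len_cases n3 r3 ->
  r3 <= 1/3 -> (n1 <= n0)%N -> (n2 <= n0)%N -> (n3 <= n0)%N -> 1/41 <= r0 ->
  0 < k -> k = r0 + r1 + r2 + r3 - 1 ->
  c0 <= crude k n0 n1 n2 -> c1 <= crude k n1 n2 n3 -> c2 <= crude k n2 n3 n0 ->
  c3 <= crude k n3 n0 n1 ->
  (n1 = 3%N -> n2 = 3%N -> c0 <= 0 \/ c1 <= 0) ->
  (n2 = 3%N -> n3 = 3%N -> c1 <= 0 \/ c2 <= 0) ->
  (n3 = 5%N -> n0 = 6%N -> n1 = 3%N -> c3 <= 0 \/ c0 <= 0) ->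
  c0 + c1 + c2 + c3 <= k.
Proof.
move=> h0 h1 h2 h3 r3l o1 o2 o3 small k0 kE; have hk : 1 < r0 + r1 + r2 + r3 by lra.
move: small k0 kE.
case: h0 hk o1 o2 o3 => [|||||? ? ?] hk o1 o2 o3;
case: h1 hk o1 => [|||||? ? ?] hk o1; order_prune o1; clear o1;
case: h2 hk o2 => [|||||? ? ?] hk o2; order_prune o2; clear o2; try absurd_lra;
case: h3 hk o3 r3l => [|||||? ? ?] hk o3 r3l; order_prune o3; clear o3 r3l;
try absurd_lra; clear hk;
have [m3 m1] := min_bounds k (1/30); have [m4 m2] := min_bounds k (1/41 + 1/60);
rewrite /= => small k0 kE C0 C1 C2 C3 e1 e2 e3;
first [ clear e1 e2 e3; lra
      | by case: (e1 erefl erefl) => ?; case: (e3 erefl erefl erefl) => ?; lra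
      | by case: (e2 erefl erefl) => ?; lra ].
Qed.

Lemma len3_of_max n n0 x x0 : len_cases n x -> len_cases n0 x0 -> (n <= n0)%N ->
  1/2 < x + x0 -> n = 3%N.
Proof.
move=> h h0 o hx.
case: h0 hx o => [|||||? ? ?] hx o; case: h hx o => [|||||? ? ?] hx o;
  order_prune o; first [reflexivity | absurd_lra].
Qed.

(** The critical type is (5,3,3,3,3), of curvature 1/30: either at most one triangle pays, or just
    the two next to the pentagon, 1/105 each. *)
Lemma budget5 (k r0 : rat) n0 (c0 c1 c2 c3 c4 : rat) :
  len_cases n0 r0 -> 0 < k -> k = r0 + 1/3 + 1/3 + 1/3 + 1/3 - 3/2 ->
  c0 <= crude k n0 3 3 -> c1 <= crude k 3 3 3 -> c2 <= crude k 3 3 3 ->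
  c3 <= crude k 3 3 n0 -> c4 <= crude k 3 n0 3 ->
  c0 <= 0 \/ c1 <= 0 -> c1 <= 0 \/ c2 <= 0 -> c2 <= 0 \/ c3 <= 0 ->
  c0 <= 0 \/ c2 <= 0 -> c1 <= 0 \/ c3 <= 0 ->
  c0 + c1 + c2 + c3 + c4 <= k.
Proof.
move=> h0 k0 kE.
have [_ m1] := min_bounds k (1/30).
case: h0 kE => [|||||? ? ?] kE; try absurd_lra; rewrite /= => C0 C1 C2 C3 C4;
  try (move=> _ _ _ _ _; lra).
by move=> [?|?] [?|?] [?|?] [?|?] [?|?]; lra.
Qed.

Lemma porbit_max x : exists2 y, y \in porbit s x &
  forall u, u \in porbit s y -> (L u <= L y)%N.
Proof.
pose P := [pred y in porbit s x].
have Px : P x by rewrite /= porbit_id.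
case: (@arg_maxnP _ x P (fun y => L y) Px) => y Py hy.
by exists y => // u; rewrite (porbit_eq Py); apply: hy.
Qed.

Lemma le0_or (u v : rat) : (0 < u -> 0 < v -> False) -> u <= 0 \/ v <= 0.
Proof.
by case: (leP u 0) => hu; [left|case: (leP v 0) => hv h; [right|case: (h isT isT)]].
Qed.

Lemma cl_hexE e : L (s e) = 6%N -> cl e = clZ e.
Proof.
move=> h; rewrite /cl; case: (clTP e) => [->|[d [_ eE ->]]]; first by rewrite add0r.
have hd : L (s d) = 6%N by rewrite -L_sq -eE.
rewrite gifts_ntri; last by rewrite hd.
by rewrite /claimQ hd andbF !add0r.
Qed.

Lemma budget_max x : (forall u, u \in porbit s x -> (L u <= L x)%N) -> ~~ large x ->
  \sum_(e in porbit s x) cl e <= K x.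
Proof.
move=> hmax /r_small small.
have mem u : u \in porbit s x -> s u \in porbit s x by rewrite s_porbit.
have m0 := porbit_id s x; have m1 := mem _ m0; have m2 := mem _ m1; have m3 := mem _ m2.
have m4 := mem _ m3.
have Kx := Kpos x.
have c0 := cl_le x; have c1 := cl_le (s x); have c2 := cl_le (s (s x)).
have c3 := cl_le (s (s (s x))); have c4 := cl_le (s (s (s (s x)))).
rewrite !K_s in c1 c2 c3 c4.
case: (dgP x) => hd.
- rewrite (sum3 _ hd); rewrite !(s3 hd) in c1 c2.
  exact: (budget3 (len_casesP _) (len_casesP _) (len_casesP _)
    (hmax _ m1) (hmax _ m2) small Kx (K3 hd) c0 c1 c2).
- rewrite (sum4 _ hd); rewrite !(s4 hd) in c1 c2 c3.
  have [_ r3] := andP (r_bound (s (s (s x)))).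
  apply: (budget4 (len_casesP _) (len_casesP _) (len_casesP _) (len_casesP _)
    r3 (hmax _ m1) (hmax _ m2) (hmax _ m3) small Kx (K4 hd) c0 c1 c2 c3).
  + by move=> l1 l2; apply: le0_or; apply: cl_adj.
  + by move=> l2 l3; apply: le0_or; apply: cl_adj.
  + move=> l3 l0 l1; have sx := s4 hd.
    apply: le0_or; rewrite cl_hexE; last by rewrite sx.
    move=> /lt0r_neq0 hZ h0; apply: (cl_pent l3 _ _ hZ); rewrite sx.
    * exact: l0.
    * exact: l1.
    * exact: h0.
- rewrite (sum5 _ hd); rewrite !(s5 hd) in c1 c2 c3 c4.
  have kE := K5 hd.
  have [_ r1] := andP (r_bound (s x)); have [_ r2] := andP (r_bound (s (s x))).
  have [_ r3] := andP (r_bound (s (s (s x)))).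
  have [_ r4] := andP (r_bound (s (s (s (s x))))).
  have lc := len_casesP.
  have l1 : L (s x) = 3%N by apply: len3_of_max (lc _) (lc x) (hmax _ m1) _; lra.
  have l2 : L (s (s x)) = 3%N by apply: len3_of_max (lc _) (lc x) (hmax _ m2) _; lra.
  have l3 : L (s (s (s x))) = 3%N by apply: len3_of_max (lc _) (lc x) (hmax _ m3) _; lra.
  have l4 : L (s (s (s (s x)))) = 3%N.
    by apply: len3_of_max (lc _) (lc x) (hmax _ m4) _; lra.
  rewrite l1 l2 l3 l4 in c0 c1 c2 c3 c4.
  have kE3 : K x = r x + 1/3 + 1/3 + 1/3 + 1/3 - 3/2.
    by rewrite kE (r_eq l1) (r_eq l2) (r_eq l3) (r_eq l4); lra.
  apply: (budget5 (lc x) Kx kE3 c0 c1 c2 c3 c4); apply: le0_or.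
  + exact: cl_adj.
  + exact: cl_adj.
  + exact: cl_adj.
  + exact: cl_dist2.
  + exact: cl_dist2.
Qed.

Lemma large_unique y : large y -> forall u, u \in porbit s y -> u != y -> ~~ large u.
Proof.
move=> hy u hu nuy; rewrite /large -leqNgt.
case: (large_dg hy) => hd.
  case: (in_porbit3 hd hu) nuy => -> ; rewrite ?eqxx // => _;
  by case: (largeP hy).
have [h1 h2 h3] := large4 hy hd.
by case: (in_porbit4 hd hu) nuy => -> ; rewrite ?eqxx ?h1 ?h2 ?h3.
Qed.

(** On a large face [crude] allows a claim only between two quadrilaterals or on the middle one of
    three triangles. These would start a prism or an antiprism. *)
Lemma cl_large y : large y -> \sum_(e in porbit s y) cl e <= 0.
Proof.
move=> hy; have c0 := cl_le y; have c1 := cl_le (s y); have c2 := cl_le (s (s y)).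
have c3 := cl_le (s (s (s y))).
have [m hm] : exists m, L y = m.+4.+4.
  have h8 : (7 < L y)%N by apply: leq_trans hy.
  by exists (L y - 8)%N; exact: esym (subnKC h8).
case: (large_dg hy) => hd; [rewrite (sum3 _ hd)|rewrite (sum4 _ hd)].
  rewrite !(s3 hd) hm in c0 c1 c2.
  have q44 : L (s y) = 4%N -> L (s (s y)) = 4%N -> cl (s y) <= 0.
    move=> h1 h2; rewrite /cl; case: (clZ_len (s y)) => [->|[]]; last by rewrite h1.
    rewrite addr0; case: (clTP (s y)) => [->|[d [hl eE ->]]]; first exact: lexx.
    have hd4 : L (s d) = 4%N by rewrite -L_sq -eE.
    rewrite gifts_ntri; last by rewrite hd4.
    rewrite add0r /claimQ; case: ifP => [/and3P[/eqP g1 _ /eqP g2]|_]; last exact: lexx.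
    have hq : dg (q d) = 3%N by rewrite -eE dg_s.
    by case/negP: (no_large_quad hl g1 hd4 g2 hq); rewrite -eE s3.
  move: q44 c0 c1 c2; case: (largeP hy) => /= q44 c0 c1 c2; try lra.
  by have := q44 erefl erefl; lra.
have [l1 l2 l3] := large4 hy hd.
rewrite !(s4 hd) hm l1 l2 l3 /= in c0 c1 c2 c3.
suff : cl (s y) <= 0 by lra.
case: (leP (cl (s y)) 0) => // /(cl_tri l2)[d [hl eE hd3 /(_ l1) g1 /(_ l3) g2]].
have hq : dg (q d) = 4%N by rewrite -eE dg_s.
have [_ /(_ hq)] := apex333 hl g1 g2.
by rewrite -eE s4 // hy.
Qed.

Lemma budget x : \sum_(e in porbit s x) (cl e + (if e \in sigma then K e else 0)) <= K x.
Proof.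
rewrite big_split /=.
have [/exists_inP[y hy ly]|none] := boolP [exists y in porbit s x, large y].
  rewrite -(porbit_eq hy) -(K_porbit hy).
  have := cl_large ly; have := Kpos y.
  rewrite [X in _ + X](bigD1 y) ?porbit_id //= [X in _ + (_ + X)]big1 => [|u /andP[hu nu]].
    by case: ifP => _ *; lra.
  by rewrite ifF //; apply: contraNF (large_unique ly hu nu); apply: large_sigma.
have small u : u \in porbit s x -> ~~ large u.
  by move=> hu; apply: contra none => lu; apply/exists_inP; exists u.
rewrite [X in _ + X]big1 => [|u hu]; last first.
  by rewrite ifF //; apply: contraNF (small u hu); apply: large_sigma.
(* The rotation is restarted at the longest face, as [budget_max] requires. *)
have [y hy ymax] := porbit_max x.
rewrite addr0 -(porbit_eq hy) -(K_porbit hy).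
exact: budget_max ymax (small y hy).
Qed.

Lemma sum_cl : \sum_e cl e =
  \sum_(d in sigma) (giftL d + giftR d + claimQ d + claimZ d).
Proof.
rewrite [RHS]big_split big_split /=; congr (_ + _).
  rewrite (reindex_inj (@perm_inj _ q)) [RHS]big_mkcond /=.
  by apply: eq_bigr => d _; rewrite /clT permK.
rewrite (reindex_inj (@perm_inj _ z)) [RHS]big_mkcond /=.
by apply: eq_bigr => d _; rewrite /clZ permK.
Qed.

Lemma charge d : large d -> r (phi d) + 1/41 <=
  K (phi d) + giftL (phi d) + giftR d + claimQ (phi d) + claimZ (phi d).
Proof.
move=> hl; have hlg : large (phi d) by rewrite large_phi.
by case: (large_dg hlg) => hd; [apply: charge3|apply: charge4].
Qed.

(** The budgets add up to at most 2, while the charges around the face add up to at least 1 +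
    42/41. *)
Lemma no_large_face : False.
Proof.
have ub : \sum_e (cl e + (if e \in sigma then K e else 0)) <= 2.
  rewrite -total_curvature (sum_avg_porbit s); apply: ler_sum => x _.
  rewrite ler_pM2l ?budget // invr_gt0 ltr0n.
  exact: card_porbit_gt0.
have shift (F : D -> rat) : \sum_(d in sigma) F d = \sum_(d in sigma) F (phi d).
  rewrite (reindex_inj (@perm_inj _ phi)) /=.
  by apply: eq_bigl => d; rewrite phi_sigma.
have lb : \sum_(d in sigma) (r (phi d) + 1/41) <=
    \sum_e (cl e + (if e \in sigma then K e else 0)).
  rewrite [X in _ <= X]big_split /= sum_cl -big_mkcond /=.
  (* [giftR d] goes to the vertex of [phi d], so the other terms are shifted along the face to meet
     it there. *)
  have shift_all (A B C E F : D -> rat) :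
      \sum_(d in sigma) (A d + B d + C d + E d) + \sum_(d in sigma) F d =
      \sum_(d in sigma) (F (phi d) + A (phi d) + B d + C (phi d) + E (phi d)).
    by rewrite !big_split /= (shift A) (shift C) (shift E) (shift F); ring.
  rewrite shift_all.
  by apply: ler_sum => d /(large_sigma large0); apply: charge.
have rE : \sum_(d in sigma) (r (phi d) + 1/41) = 1 + (L d0)%:R / 41.
  rewrite (eq_bigr (fun=> (L d0)%:R^-1 + 1/41)) => [|d hd].
    rewrite sumr_const -[#|_|]/(L d0) -(mulr_natr (_ + _)).
    field; rewrite pnatr_eq0 -lt0n; exact: leq_trans (L_ge3 d0).
  by rewrite /r L_phi /face_len (porbit_eq hd).
have : (42%:R : rat) <= (L d0)%:R by rewrite ler_nat.
move: ub lb; rewrite rE => ub lb hL; absurd_lra.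
Qed.

End Claims.

End Map.

Theorem theorem13p1 (D : finType) (s a : {perm D}) :
  planar_PCC s a -> forall d : D, (face_len s a d <= 41)%N.
Proof.
case=> sph Kpos deg3 nprism nanti d; rewrite leqNgt; apply/negP => hl.
exact: (no_large_face sph Kpos deg3 nprism nanti hl).
Qed.
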